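(* Let $m\in \mathbb{N}\setminus \{1\}$ (with $m=0$ allowed, $\mathbb{Z}/0=\mathbb{Z}$). Then $\mathbb{Z}\times \mathbb{Z}/m$ with $$\sigma_{(a_1,a_2)}(b_1,b_2)=(b_1+1,\ a_1+b_1+b_2)$$ (second coordinate taken in $\mathbb{Z}/m$) is an infinite indecomposable involutive solution with permutation group isomorphic to $\mathbb{Z}\times \mathbb{Z}/m$ and multipermutation level $2$. Moreover, every infinite indecomposable involutive solution with abelian permutation group and multipermutation level $2$ is isomorphic to such a solution for some $m\in\mathbb{N}\setminus\{1\}$.
   Context: A solution is a pair $(X,r)$ with $X$ a nonempty set and $r:X^2\to X^2$ a bijection, $r(x,y)=(\sigma_x(y),\tau_y(x))$, satisfying the braid equation $(r\times \mathrm{id})(\mathrm{id}\times r)(r\times \mathrm{id})=(\mathrm{id}\times r)(r\times \mathrm{id})(\mathrm{id}\times r)$ with all $\sigma_x,\tau_x$ bijective. It is involutive if $r^2=\mathrm{id}$; in that case $r$ is determined by the maps $\sigma_x$ through $r(x,y)=(\sigma_x(y),\sigma^{-1}_{\sigma_x(y)}(x))$. It is indecomposable if the group generated by all $\sigma_x,\tau_x$ is transitive on $X$; its permutation group is $\langle(\sigma_x,\tau_x^{-1})\mid x\in X\rangle\le\mathrm{Perm}(X)^2$. Isomorphisms $(X,r)\to(Y,s)$ are bijections $f$ with $(f\times f)r=s(f\times f)$. $\mathrm{Ret}(X,r)$ is the induced solution on $X/{\sim}$, where $x\sim y$ iff $\sigma_x=\sigma_y$ and $\tau_x=\tau_y$;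 the multipermutation level is the smallest $n\ge0$ such that the $n$-fold retraction $\mathrm{Ret}^n(X,r)$ has size $1$. *)

(* Defs.v *)
From HB Require Import structures.
From mathcomp Require Import all_boot ssralg ssrint zmodp.
From mathcomp Require Import boolp classical_sets functions cardinality.
Set Implicit Arguments.
Unset Strict Implicit.
Unset Printing Implicit Defensive.
Import GRing.Theory.
Local Open Scope classical_set_scope.
Local Open Scope quotient_scope.

(** * The group of permutations of a possibly infinite type *)

(* A permutation is stored with its inverse; by extensionality and proof
   irrelevance it is determined by the underlying function, see [PermP]. *)
Record Perm (X : Type) := MkPerm {
  perm_fun :> X -> X;
  perm_fun_inv : X -> X;
  perm_funK : cancel perm_fun perm_fun_inv;
  perm_fun_invK : cancel perm_fun_inv perm_fun }.

Lemma PermP (X : Type) (g h : Perm X) : g =1 h -> g = h.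
Proof.
case: g h => [f f' fK f'K] [k k' kK k'K] /= /funext fk; subst k.
have E : f' = k' by apply/funext => x; rewrite -{1}(k'K x) fK.
by subst k'; congr MkPerm; exact: Prop_irrelevance.
Qed.

HB.instance Definition _ (X : Type) := gen_eqMixin (Perm X).
HB.instance Definition _ (X : Type) := gen_choiceMixin (Perm X).

Section PermGroup.
Context {X : Type}.
Implicit Types g h k : Perm X.

Definition Perm1 : Perm X := @MkPerm X id id (frefl _) (frefl _).
Definition PermV g : Perm X := MkPerm (perm_fun_invK g) (@perm_funK X g).
(* (g * h) x = g (h x) *)
Definition PermM g h : Perm X :=
  MkPerm (can_comp (@perm_funK X g) (@perm_funK X h))
         (can_comp (@perm_fun_invK X h) (@perm_fun_invK X g)).

Lemma PermMA : associative PermM. Proof. by move=> g h k; apply: PermP. Qed.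
Lemma Perm1M : left_id Perm1 PermM. Proof. by move=> g; apply: PermP. Qed.
Lemma PermM1 : right_id Perm1 PermM. Proof. by move=> g; apply: PermP. Qed.
Lemma PermVM : left_inverse Perm1 PermV PermM.
Proof. by move=> g; apply: PermP => x; exact: perm_funK. Qed.
Lemma PermMV : right_inverse Perm1 PermV PermM.
Proof. by move=> g; apply: PermP => x; exact: perm_fun_invK. Qed.
End PermGroup.

HB.instance Definition _ (X : Type) := isGroup.Build (Perm X)
  (@PermMA X) (@Perm1M X) (@PermM1 X) (@PermVM X) (@PermMV X).

Section Subgroups.
Variable G : groupType.
Local Open Scope group_scope.

Definition is_subgroup (A : set G) : Prop :=
  [/\ A 1, forall g h, A g -> A h -> A (g * h) & forall g, A g -> A g^-1].

Definition generated (B : set G) : set G := smallest is_subgroup B.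

Definition abelian_set (A : set G) : Prop :=
  forall g h, A g -> A h -> commute g h.

(* The subgroup [A] is isomorphic to the additive group [V]. *)
Definition isog_additive (V : zmodType) (A : set G) : Prop :=
  exists f : V -> G,
    [/\ {morph f : x y / (x + y)%R >-> x * y}, injective f & range f = A].
End Subgroups.

(** * Set-theoretic solutions of the Yang-Baxter equation *)

Section Solutions.
Variable X : Type.
Implicit Types (r : X * X -> X * X) (x y : X).

Definition sigma r x : X -> X := fun y => (r (x, y)).1.
Definition tau r y : X -> X := fun x => (r (x, y)).2.

Definition r_id r (t : X * X * X) : X * X * X :=
  let: (x, y, z) := t in let: (x', y') := r (x, y) in (x', y', z).
Definition id_r r (t : X * X * X) : X * X * X :=
  let: (x, y, z) := t in let: (y', z') := r (y, z) in (x, y', z').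

Record is_solution r : Prop := IsSolution {
  sol_nonempty : inhabited X;
  sol_bij : bijective r;
  sol_braid : r_id r \o id_r r \o r_id r = id_r r \o r_id r \o id_r r;
  sol_sigma_bij : forall x, bijective (sigma r x);
  sol_tau_bij : forall x, bijective (tau r x) }.

Definition is_involutive r : Prop := r \o r = id.

(* The solution r(x, y) = (s_x(y), s_{s_x(y)}^{-1}(x)) given by the maps s_x. *)
Definition of_sigma (s : X -> Perm X) (p : X * X) : X * X :=
  (s p.1 p.2, (s (s p.1 p.2))^-1%g p.1).

Definition indecomposable r : Prop :=
  let gens := [set g : Perm X | exists x,
    perm_fun g = sigma r x \/ perm_fun g = tau r x] in
  forall x y, exists2 g, generated gens g & g x = y.

Definition permutation_group r : set (Perm X * Perm X) :=
  generated [set g : Perm X * Perm X | exists x,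
    perm_fun g.1 = sigma r x /\ perm_fun g.2^-1%g = tau r x].
End Solutions.

Definition isomorphic_sol (X Y : Type)
    (r : X * X -> X * X) (s : Y * Y -> Y * Y) : Prop :=
  exists2 f : X -> Y, bijective f &
    forall x y, let: (x', y') := r (x, y) in (f x', f y') = s (f x, f y).

(** * Retraction and multipermutation level *)

Section Retraction.
Variables (X : Type) (r : X * X -> X * X).

Definition ret_rel : rel {classic X} :=
  fun x y => `[< sigma r x = sigma r y /\ tau r x = tau r y >].

Lemma ret_rel_equiv : equiv_class_of ret_rel.
Proof.
split=> [x|x y|y x z].
- exact/asboolP.
- by apply/asboolP/asboolP => -[-> ->].
- move=> /asboolP[sy ty] /asboolP[sx tx].
  by apply/asboolP; rewrite sy ty.
Qed.
Definition ret_equiv : equiv_rel {classic X} := EquivRelPack ret_rel_equiv.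

Definition ret : Type := {eq_quot ret_equiv}.
Definition ret_pi (x : X) : ret := \pi_({eq_quot ret_equiv}) (x : {classic X}).

(* The induced map, computed on representatives; it does not depend on their
   choice when r is a solution, see [ret_mapE]. *)
Definition ret_map (p : ret * ret) : ret * ret :=
  let: (x, y) := r (repr p.1 : X, repr p.2 : X) in (ret_pi x, ret_pi y).

Lemma ret_piP x y :
  ret_pi x = ret_pi y <-> sigma r x = sigma r y /\ tau r x = tau r y.
Proof.
rewrite /ret_pi; split=> [/eqP|xy]; first by rewrite eqmodE => /asboolP.
by apply/eqP; rewrite eqmodE; apply/asboolP.
Qed.

Hypothesis solr : is_solution r.

Lemma sol_sigmaM x y z :
  sigma r x (sigma r y z) = sigma r (sigma r x y) (sigma r (tau r y x) z).
Proof.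
have := congr1 (fun f => (f (x, y, z)).1.1) (sol_braid solr).
rewrite /sigma /tau /r_id /id_r /=.
case: (r (x, y)) => a b /=; case: (r (b, z)) => c d /=.
case: (r (a, c)) => e f /=; case: (r (y, z)) => g h /=.
by case: (r (x, g)) => i j /=; case: (r (j, h)).
Qed.

Lemma sol_tauM x y z :
  tau r z (tau r y x) = tau r (tau r z y) (tau r (sigma r y z) x).
Proof.
have := congr1 (fun f => (f (x, y, z)).2) (sol_braid solr).
rewrite /sigma /tau /r_id /id_r /=.
case: (r (x, y)) => a b /=; case: (r (b, z)) => c d /=.
case: (r (a, c)) => e f /=; case: (r (y, z)) => g h /=.
by case: (r (x, g)) => i j /=; case: (r (j, h)).
Qed.

Lemma ret_congr x x' y y' : ret_pi x = ret_pi x' -> ret_pi y = ret_pi y' ->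
  ret_pi (sigma r x y) = ret_pi (sigma r x' y') /\
  ret_pi (tau r y x) = ret_pi (tau r y' x').
Proof.
have cancel_r (f g h : X -> X) : bijective f -> g \o f = h \o f -> g = h.
  case=> f' _ f'K gh; apply/funext => t.
  by have /= := congr1 (@^~ (f' t)) gh; rewrite f'K.
have cancel_l (f g h : X -> X) : bijective f -> f \o g = f \o h -> g = h.
  case=> f' fK _ gh; apply/funext => t; apply: (can_inj fK).
  exact: (congr1 (@^~ t) gh).
have sM a b : sigma r (sigma r a b) \o sigma r (tau r b a) =
  sigma r a \o sigma r b by apply/funext => t /=; rewrite -sol_sigmaM.
have tM a b : tau r (tau r b a) \o tau r (sigma r a b) =
  tau r b \o tau r a by apply/funext => t /=; rewrite -sol_tauM.
move=> /ret_piP[sx tx] /ret_piP[sy ty].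
have step1 a : ret_pi (sigma r a y) = ret_pi (sigma r a y').
  apply/ret_piP; split.
    apply: (cancel_r _ _ _ (sol_sigma_bij solr (tau r y a))).
    by rewrite sM ty sM sy.
  apply: (cancel_l _ _ _ (sol_tau_bij solr (tau r y a))).
  by rewrite tM ty tM.
have step2 b : ret_pi (tau r b x) = ret_pi (tau r b x').
  apply/ret_piP; split.
    apply: (cancel_l _ _ _ (sol_sigma_bij solr (sigma r x b))).
    by rewrite sM sx sM.
  apply: (cancel_r _ _ _ (sol_tau_bij solr (sigma r x b))).
  by rewrite tM sx tM tx.
by split; [rewrite step1 sx | rewrite step2 ty].
Qed.

Lemma ret_mapE x y :
  ret_map (ret_pi x, ret_pi y) = (ret_pi (sigma r x y), ret_pi (tau r y x)).
Proof.
have piK u : ret_pi (repr (ret_pi u) : X) = ret_pi u by exact: reprK.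
have [<- <-] := ret_congr (piK x) (piK y).
by rewrite /ret_map /sigma /tau /=; case: (r _).
Qed.
End Retraction.

Record braiding := Braiding {
  carrier : Type;
  braid_map : carrier * carrier -> carrier * carrier }.

Definition Ret (S : braiding) : braiding := Braiding (@ret_map _ (@braid_map S)).

Definition size_one (T : Type) : Prop := exists x : T, forall y : T, y = x.

Definition multipermutation_level (X : Type) (r : X * X -> X * X) (n : nat) :=
  size_one (carrier (iter n Ret (Braiding r))) /\
  forall k, k < n -> ~ size_one (carrier (iter k Ret (Braiding r))).

(** * The solutions on Z x Z/m *)

Local Open Scope ring_scope.

(* 'I_p.+1 carries addition modulo p.+1; unlike 'Z_m, this is also the right
   group for m = 0 (namely Z) and for m = 1. *)
Definition Zmod (m : nat) : zmodType := if m is p.+1 then 'I_p.+1 else int.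

Definition Zmod1 (m : nat) : Zmod m :=
  match m return Zmod m with p.+1 => inZp 1 : 'I_p.+1 | 0 => 1 : int end.

Definition to_Zmod (m : nat) (a : int) : Zmod m := Zmod1 m *~ a.

Section ZZmod.
Variable m : nat.
Implicit Types a b : int * Zmod m.

Definition sZ_fun a b : int * Zmod m :=
  (b.1 + 1, to_Zmod m a.1 + to_Zmod m b.1 + b.2).

Definition sZ_inv a b : int * Zmod m :=
  (b.1 - 1, b.2 - (to_Zmod m a.1 + to_Zmod m (b.1 - 1))).

Lemma sZ_funK a : cancel (sZ_fun a) (sZ_inv a).
Proof. by case=> b1 b2; rewrite /sZ_fun /sZ_inv /= addrK addrC addKr. Qed.

Lemma sZ_invK a : cancel (sZ_inv a) (sZ_fun a).
Proof. by case=> b1 b2; rewrite /sZ_fun /sZ_inv /= subrK addrC subrK. Qed.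

Definition sZ a : Perm (int * Zmod m) := MkPerm (sZ_funK a) (sZ_invK a).

Definition solZ : (int * Zmod m) * (int * Zmod m) ->
  (int * Zmod m) * (int * Zmod m) := of_sigma sZ.
End ZZmod.
Arguments solZ m p : clear implicits.

(* Main.v *)
(* For an involutive solution of level 2 the class of sigma_x(y) in the
   retraction does not depend on x, so the tau's are inverses of sigma's, and
   sigma_x sigma_y = sigma_(sigma_x(y)) sigma_(tau_y(x)).  If the sigma's
   commute and e_k is the permutation attached to the class of s^k(x0), where
   s = sigma_(x0), this reads e_i e_j = e_(j+1) e_(i-1), so e_k = s t^k with
   t = e_1 e_0^-1.  By indecomposability the abelian group <s, t> is transitive,
   hence regular.  A relation s^i t^j = 1 preserves classes, so t^i = 1;
   for i <> 0 this makes s and t of finite order, so if X is infinite the only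
   relations are t^(m q) = 1.  Therefore X is Z x Z/m, with
   sigma_a(b) = (b1 + 1, a1 + b2), and the shear
   (b1, b2) |-> (b1, b2 + b1 (b1 - 1) / 2) turns this into solZ m. *)
Require Import Defs.
From mathcomp Require Import all_boot ssralg ssrint.
From mathcomp Require Import boolp classical_sets functions cardinality.
From mathcomp Require Import ssrnum zmodp intdiv generic_quotient zify ring.
Set Implicit Arguments.
Unset Strict Implicit.
Unset Printing Implicit Defensive.

(** * Integers, triangular numbers and reduction modulo [m] *)

Section Integers.
Import GRing.Theory.
Local Open Scope ring_scope.

(** The step is an equivalence so that one hypothesis serves both directions; in a group it follows
    by cancelling a factor. *)
Lemma int_succ_ind (P : int -> Prop) :
  P 0%R -> (forall k, P k <-> P (k + 1)%R) -> forall k, P k.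
Proof.
move=> P0 PS; elim/int_rect=> [//|n /PS|n Pn]; first by rewrite addrC -intS.
by apply/PS; rewrite intS opprD addrAC addNr add0r.
Qed.

(** The binomial coefficient [k] choose 2, also for negative [k]; the division is exact. *)
Definition tri (k : int) : int := (k * (k - 1) %/ 2)%Z.

Lemma tri_double k : 2 * tri k = k * (k - 1).
Proof.
rewrite mulrC divzK //; elim/int_succ_ind: k => // k.
have -> : (k + 1) * (k + 1 - 1) = k * (k - 1) + k * 2 :> int by ring.
by rewrite (rpredDr _ (dvdz_mull k (dvdzz 2))).
Qed.

Lemma triD k l : tri (k + l) = tri k + tri l + k * l.
Proof.
by apply: (@mulfI int 2) => //; rewrite !mulrDr !tri_double; ring.
Qed.

Lemma to_ZmodD m : {morph to_Zmod m : a b / a + b}.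
Proof. by move=> a b; rewrite /to_Zmod mulrzDr. Qed.

Lemma to_Zmod0 m : to_Zmod m 0%R = 0. Proof. by []. Qed.

Lemma to_ZmodN m : {morph to_Zmod m : a / - a}.
Proof. by move=> a; rewrite /to_Zmod mulrNz. Qed.

Lemma to_Zmod_surj m (u : Zmod m) : exists a, to_Zmod m a = u.
Proof.
case: m u => [|p] u; first by exists u; rewrite /to_Zmod /= mulrzz mul1r.
exists (u : nat)%:Z; rewrite /to_Zmod /= -pmulrn Zp_mulrn.
by apply: val_inj; rewrite /= modnMml mul1n modn_small.
Qed.

Lemma to_Zmod_eq0 m a : to_Zmod m a = 0 <-> (m %| a)%Z.
Proof.
case: m => [|p].
  by rewrite /to_Zmod /= mulrzz mul1r dvd0z; split=> /eqP.
have natE (n : nat) : to_Zmod p.+1 n = 0 <-> (p.+1 %| n%:Z)%Z.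
  rewrite /to_Zmod /= -pmulrn Zp_mulrn; split=> [/(congr1 val)|] /=.
    by rewrite modnMml mul1n => /eqP.
  by move=> pn; apply: val_inj; rewrite /= modnMml mul1n; apply/eqP.
case: a => n; first exact: natE.
rewrite NegzE to_ZmodN rpredN -natE; split=> [/eqP|->]; last by rewrite oppr0.
by rewrite oppr_eq0 => /eqP.
Qed.
End Integers.

(** * Generated subgroups *)

Section Generation.
Local Open Scope group_scope.
Variable G : groupType.

Lemma generated_subgroup (B : set G) : is_subgroup (generated B).
Proof.
split=> [H [[]]//|g h gB hB H HB|g gB H HB].
  by case: (HB) => -[_ HM _] _; apply: HM; [exact: gB | exact: hB].
by case: (HB) => -[_ _ HV] _; apply: HV; exact: gB.
Qed.

Lemma generated_sub (B : set G) g : B g -> generated B g.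
Proof. by move=> Bg H [_]; exact. Qed.

Import GRing.Theory.

(** The elements [(1, to_Zmod m a)] generate Z x Z/m: [a = 0] yields all [(k, 0)], and
    [(k, u) = (k - 1, 0) + (1, u)]. *)
Lemma subgroup_additive (m : nat) (A : set G) (f : int * Zmod m -> G) :
  is_subgroup A -> {morph f : x y / (x + y)%R >-> x * y} ->
  (forall a, A (f (1, to_Zmod m a)%R)) -> forall x, A (f x).
Proof.
case=> A1 AM AV fD Af.
have f0 : f 0%R = 1 by apply: (mulIg (f 0%R)); rewrite -fD addr0 mul1g.
have fN x : f (- x)%R = (f x)^-1.
  by apply: (mulIg (f x)); rewrite -fD addNr f0 mulVg.
have Af1 (k : int) : A (f (k, 0)%R).
  have Af10 : A (f (1, 0)%R) by have := Af 0%R; rewrite to_Zmod0.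
  elim/int_succ_ind: k => [|k]; first by rewrite f0.
  have -> : f (k + 1, 0)%R = f (k, 0)%R * f (1, 0)%R.
    by rewrite -fD; congr (f (_, _)); rewrite addr0.
  split=> [/AM|Ak]; first exact.
  by rewrite -(mulgK (f (1, 0)%R) (f (k, 0)%R)); apply: AM => //; apply: AV.
case=> k u; have [a <-] := to_Zmod_surj u.
have -> : (k, to_Zmod m a) = ((k - 1, 0) + (1, to_Zmod m a))%R.
  by congr (_, _); rewrite ?subrK ?add0r.
by rewrite fD; apply: AM.
Qed.
End Generation.

(** * One-point retractions *)

Lemma ret_pi_surj (X : Type) (r : X * X -> X * X) (c : ret r) :
  exists x, ret_pi r x = c.
Proof. by exists (repr c); exact: reprK. Qed.

Lemma size_one_ret (X : Type) (r : X * X -> X * X) (x0 : X) :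
  size_one (ret r) <->
  forall x y, sigma r x = sigma r y /\ tau r x = tau r y.
Proof.
split=> [[c cP] x y|H]; first by apply/ret_piP; rewrite !(cP (ret_pi r _)).
by exists (ret_pi r x0) => c; have [x <-] := ret_pi_surj c; apply/ret_piP.
Qed.

(** This is [size_one_ret] for the retraction, whose maps are computed on classes by [ret_mapE]. *)
Lemma size_one_ret_ret (X : Type) (r : X * X -> X * X) (x0 : X) :
  is_solution r ->
  size_one (ret (@ret_map _ r)) <->
  forall x y z, ret_pi r (sigma r x z) = ret_pi r (sigma r y z) /\
                ret_pi r (tau r x z) = ret_pi r (tau r y z).
Proof.
move=> solr; rewrite (size_one_ret _ (ret_pi r x0)).
have sE x z : sigma (@ret_map _ r) (ret_pi r x) (ret_pi r z) =
    ret_pi r (sigma r x z).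
  by rewrite {1}/sigma ret_mapE.
have tE x z : tau (@ret_map _ r) (ret_pi r x) (ret_pi r z) =
    ret_pi r (tau r x z).
  by rewrite {1}/tau ret_mapE.
split=> H x y; last first.
  have [[x' <-] [y' <-]] := (ret_pi_surj x, ret_pi_surj y).
  by split; apply/funext=> z; have [z' <-] := ret_pi_surj z;
    rewrite ?sE ?tE; case: (H x' y' z').
move=> z; have [sxy txy] := H (ret_pi r x) (ret_pi r y).
by rewrite -!sE -!tE sxy txy.
Qed.

(** * The solutions on Z x Z/m *)

Section Shifts.
Import GRing.Theory.
Local Open Scope classical_set_scope.
Local Open Scope ring_scope.
Variable m : nat.
Local Notation to := (to_Zmod m).
Local Notation Y := (int * Zmod m)%type.

(* [shift_fun (k, to u) = sigma_0^k T^u] with [T (x, y) = (x, y + 1)]. *)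
Definition shift_fun (a z : Y) : Y :=
  (z.1 + a.1, z.2 + to (a.1 * z.1 + tri a.1) + a.2).

(** The cross term [k * l] in [triD] absorbs the change of first coordinate made by the inner
    shift. *)
Lemma shift_funD a b z : shift_fun a (shift_fun b z) = shift_fun (a + b) z.
Proof.
case: a b z => [k u] [l v] [x y]; rewrite /shift_fun /=; congr (_, _).
  by rewrite -addrA [l + k]addrC.
have -> : (k + l) * x + tri (k + l) = (l * x + tri l) + (k * (x + l) + tri k).
  by rewrite triD; ring.
rewrite (to_ZmodD _ (_ + _) (_ + tri k)); move: (to _) (to _) => A B.
by rewrite [_ + v + _]addrAC [u + v]addrC !addrA.
Qed.

Lemma shift_fun0 z : shift_fun 0 z = z.
Proof.
by case: z => x y; rewrite /shift_fun /= mul0r !addr0.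
Qed.

Lemma shift_funK a : cancel (shift_fun a) (shift_fun (- a)).
Proof. by move=> z; rewrite shift_funD addNr shift_fun0. Qed.

Lemma shift_funVK a : cancel (shift_fun (- a)) (shift_fun a).
Proof. by move=> z; rewrite shift_funD subrr shift_fun0. Qed.

Definition shift a : Perm Y := MkPerm (shift_funK a) (shift_funVK a).

Lemma shiftD a b : shift (a + b) = (shift a * shift b)%g.
Proof. by apply: PermP => z; rewrite /= shift_funD. Qed.

Lemma shift_inj : injective shift.
Proof.
move=> [k u] [l v] /(congr1 (fun g : Perm Y => g 0)) [].
by rewrite !add0r !mulr0 !add0r => -> /addrI ->.
Qed.

(** This closed form reduces involutivity and the braid equation to integer identities under
    [to]. *)
Lemma solZE x y : solZ m (x, y) =
  ((y.1 + 1, y.2 + to (x.1 + y.1)), (x.1 - 1, x.2 + to (- (x.1 + y.1)))).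
Proof.
case: x y => [x1 x2] [y1 y2]; rewrite /solZ /of_sigma /= /sZ_fun /sZ_inv /=.
congr (_, _, (_, _)); first by rewrite to_ZmodD addrC.
rewrite -to_ZmodD -to_ZmodN; congr (_ + to _); ring.
Qed.

Lemma sigma_solZ x : sigma (solZ m) x = shift (1, to x.1).
Proof.
apply/funext=> y; rewrite /sigma solZE /= /shift_fun /=; congr (_, _).
by rewrite mul1r addr0 -addrA -to_ZmodD [y.1 + _]addrC.
Qed.

Lemma tau_solZ y : tau (solZ m) y = shift (- (1, to (y.1 + 1))).
Proof.
apply/funext=> x; rewrite /tau solZE /= /shift_fun /=; congr (_, _).
rewrite -to_ZmodN -addrA -to_ZmodD; congr (_ + to _).
(* The value [tri (- 1) = 1] cancels the 1 in [y.1 + 1]. *)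
by have -> : tri (- 1) = 1 by []; ring.
Qed.

Lemma shift_bij a : bijective (shift a).
Proof. by exists (shift (- a)); [exact: shift_funK | exact: shift_funVK]. Qed.

Lemma solZ_involutive : is_involutive (solZ m).
Proof.
apply/funext=> -[[x1 x2] [y1 y2]]; rewrite /= !solZE /=.
by congr (_, _, (_, _)); rewrite ?subrK ?addrK // -addrA -to_ZmodD;
  rewrite [X in to X](_ : _ = 0) ?to_Zmod0 ?addr0 //; ring.
Qed.

Lemma solZ_solution : is_solution (solZ m).
Proof.
split.
- by constructor; exact: 0.
- by exists (solZ m) => p; have := congr1 (@^~ p) solZ_involutive.
- have -> : solZ m = fun p =>
      ((p.2.1 + 1, p.2.2 + to (p.1.1 + p.2.1)),
       (p.1.1 - 1, p.1.2 + to (- (p.1.1 + p.2.1)))).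
    by apply/funext=> -[x y]; exact: solZE.
  apply/funext=> -[[[x1 x2] [y1 y2]] [z1 z2]] /=.
  by congr (_, _, (_, _), (_, _)); try ring;
    rewrite -!addrA -!to_ZmodD; congr (_ + to _); ring.
- by move=> x; rewrite sigma_solZ; exact: shift_bij.
- by move=> y; rewrite tau_solZ; exact: shift_bij.
Qed.

Lemma solZ_indecomposable : indecomposable (solZ m).
Proof.
move=> x y; pose k := y.1 - x.1.
(* Obtained by solving [shift_fun a x = y] coordinate by coordinate. *)
pose a : Y := (k, y.2 - x.2 - to (k * x.1 + tri k)).
exists (shift a); last first.
  rewrite /= /shift_fun [RHS]surjective_pairing /=; congr (_, _).
    by rewrite /k addrC subrK.
  by rewrite addrACA subrr addr0 addrC subrK.
apply: subgroup_additive; [exact: generated_subgroup | exact: shiftD |].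
move=> b; apply: generated_sub; exists (b, 0); left.
by rewrite sigma_solZ.
Qed.

Lemma infinite_intZ : infinite_set [set: Y].
Proof.
move=> fY; apply: infinite_nat.
have -> : [set: nat] = (fun n : nat => (n%:Z, 0 : Zmod m)) @^-1` [set: Y] by [].
by apply: finite_preimage fY => i j _ _ [].
Qed.

Lemma solZ_permutation_group :
  isog_additive (int * Zmod m)%type (permutation_group (solZ m)).
Proof.
(* The generator at [x] is [(shift (1, to x.1), shift (1, to (x.1 + 1)))]; the extra 1 in its second
   entry extends additively to [(0, to a.1)]. *)
pose f (a : Y) : Perm Y * Perm Y := (shift a, shift (a + (0, to a.1))).
have fD : {morph f : a b / a + b >-> (a * b)%g}.
  move=> a b; rewrite /f to_ZmodD; congr (_, _); rewrite -shiftD //.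
  by congr shift; rewrite addrACA; congr (_ + (_, _)).
have f0 : f 0 = 1%g by apply: (mulIg (f 0)); rewrite -fD addr0 mul1g.
have fV a : f (- a) = (f a)^-1%g.
  by apply: (mulIg (f a)); rewrite -fD addNr f0 mulVg.
have f1 a : f (1, to a) = (shift (1, to a), shift (1, to (a + 1))).
  by rewrite /f to_ZmodD; congr (_, shift (_, _)).
exists f; split=> // [a b /(congr1 fst)/shift_inj//|].
apply/seteqP; split=> [_ [a _ <-]|].
  apply: subgroup_additive a; [exact: generated_subgroup | exact: fD |].
  move=> a; apply: generated_sub; exists (a, 0).
  by rewrite f1 sigma_solZ tau_solZ.
apply: smallest_sub.
  split; first by exists 0.
  - by move=> _ _ [a _ <-] [b _ <-]; exists (a + b).
  - by move=> _ [a _ <-]; exists (- a).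
move=> [g h] /= [x [gE hE]]; exists (1, to x.1) => //.
rewrite f1; congr (_, _); first by apply: PermP => z; rewrite gE sigma_solZ.
apply: invg_inj; apply: PermP => z.
by rewrite (congr1 (@^~ z) hE : h^-1%g z = _) tau_solZ.
Qed.

Lemma solZ_level : m <> 1%N -> multipermutation_level (solZ m) 2.
Proof.
move=> m1; split.
  apply/(size_one_ret_ret 0 solZ_solution) => x y z.
  (* The class depends only on the first coordinate, which every sigma raises by 1 and every tau
     lowers by 1. *)
  have eqY (u v : Y) : u.1 = v.1 -> ret_pi (solZ m) u = ret_pi (solZ m) v.
    by move=> uv; apply/ret_piP; rewrite !sigma_solZ !tau_solZ uv.
  by rewrite !sigma_solZ !tau_solZ; split; apply: eqY.
case=> [_|[_|//]].
  by case=> x /= /[dup] /(_ 0) <- /(_ (1, 0)).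
(* Equal sigmas at [0] and [(1, 0)] would give [to 1 = 0], hence [m = 1]. *)
move=> /(size_one_ret (solZ m) 0)/(_ 0 (1, 0)) [] + _.
rewrite !sigma_solZ => /(congr1 (fun f => f 0)) [] /addrI /esym /to_Zmod_eq0.
by rewrite dvdz1 => /eqP.
Qed.
End Shifts.

(** * Integer powers and orders in a group *)

Section IntegerPowers.
Import GRing.Theory.
Local Open Scope group_scope.
Variable G : groupType.
Implicit Types (g h : G) (k l : int).

Definition zpow g (k : int) : G :=
  match k with Posz n => g ^+ n | Negz n => g ^- n.+1 end.

Lemma zpow1 g : zpow g 1%R = g. Proof. by []. Qed.

Lemma zpowS g k : zpow g (k + 1)%R = zpow g k * g.
Proof.
case: k => [n|[|n]]; first by rewrite -PoszD addn1 /= expgSr.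
  by rewrite /= expg1 mulVg.
have -> : (Negz n.+1 + 1)%R = Negz n by rewrite !NegzE; lia.
by rewrite /= [in RHS]expgS invgM mulgVK.
Qed.

Lemma zpowD g k l : zpow g (k + l)%R = zpow g k * zpow g l.
Proof.
elim/int_succ_ind: l => [|l]; first by rewrite addr0 mulg1.
rewrite addrA.
by rewrite (zpowS g (k + l)) (zpowS g l) mulgA; split=> [->|/mulIg].
Qed.

Lemma zpowN g k : zpow g (- k)%R = (zpow g k)^-1.
Proof.
by apply: (mulIg (zpow g k)); rewrite -(zpowD g (- k) k) addNr mulVg.
Qed.

Lemma zpow1g k : zpow (1 : G) k = 1.
Proof. by case: k => n /=; rewrite expg1n ?invg1. Qed.

Lemma zpowM g k l : zpow g (k * l)%R = zpow (zpow g k) l.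
Proof.
elim/int_succ_ind: l => [|l]; first by rewrite mulr0.
rewrite mulrDr mulr1 (zpowD g (k * l) k) (zpowS (zpow g k) l).
by split=> [->|/mulIg].
Qed.

Lemma commute_zpow g h k : commute g h -> commute g (zpow h k).
Proof. by case: k => n gh /=; [|apply: commuteV]; apply: commuteX. Qed.

Lemma zpow_mod g n k : zpow g n = 1 -> zpow g (k %% n)%Z = zpow g k.
Proof.
move=> gn; rewrite [in RHS](divz_eq k n) (zpowD g _ (k %% n)%Z).
by rewrite mulrC (zpowM g n (k %/ n)%Z) gn zpow1g mul1g.
Qed.

(** Here [m] is the least positive exponent killing [g], or 0 if there is none; a nonzero remainder
    modulo [m] would contradict minimality. *)
Lemma zpow_order g : exists m : nat, forall k, zpow g k = 1 <-> (m %| k)%Z.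
Proof.
have [[n gn]|gI] := pselect (exists n, zpow g (Posz n.+1) = 1); last first.
  exists 0%N => k; rewrite dvd0z; split=> [gk|/eqP->//].
  apply/negP => /negP; rewrite -absz_gt0 => k0; apply: gI.
  exists `|k|.-1; rewrite prednK //.
  by case: (intP k) gk => // n; rewrite zpowN => /eqP; rewrite invg_eq1 => /eqP.
have ex : exists n, `[< zpow g (Posz n.+1) = 1 >] by exists n; apply/asboolP.
exists (ex_minn ex).+1; case: ex_minnP => {gn}n /asboolP gn minn k.
split=> [gk|/dvdzP[q ->]]; last by rewrite mulrC (zpowM g _ q) gn zpow1g.
have gkn : zpow g (k %% (Posz n.+1))%Z = 1 by rewrite zpow_mod.
case E : (k %% (Posz n.+1))%Z gkn => [[|i]|i] gi.
- by apply/dvdz_mod0P; rewrite E.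
- have /minn : `[< zpow g i.+1 = 1 >] by apply/asboolP.
  have := ltz_pmod k (isT : (0 < Posz n.+1)%R).
  by rewrite E ltz_nat ltnS ltnNge => /negP.
- by have := modz_ge0 k (isT : Posz n.+1 != 0%R); rewrite E.
Qed.
End IntegerPowers.

Lemma PermME (X : Type) (g h : Perm X) x : (g * h)%g x = g (h x).
Proof. by []. Qed.

(** * Classification of the underlying permutations *)

Section Classification.
Import GRing.Theory.
Local Open Scope classical_set_scope.
Local Open Scope group_scope.
(** [C] stands for the retraction and [c] for its projection. [cycleS] encodes the braid equation,
    and [transS] indecomposability in terms of stable subsets. *)
Variables (X C : Type) (S : X -> Perm X) (c : X -> C) (x0 : X).
Hypothesis class_perm : forall x y, c x = c y -> S x = S y.
Hypothesis class_S : forall x y u v, c u = c v -> c (S x u) = c (S y v).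
Hypothesis class_SV :
  forall x y u v, c u = c v -> c ((S x)^-1 u) = c ((S y)^-1 v).
Hypothesis commS : forall x y, commute (S x) (S y).
Hypothesis cycleS :
  forall x y, S x * S y = S (S x y) * S ((S (S x y))^-1 x).
Hypothesis transS : forall O : set X,
  (forall x z, O z -> O (S x z) /\ O ((S x)^-1 z)) -> forall x y, O x -> O y.
Hypothesis infX : infinite_set [set: X].
Hypothesis nonconst : ~ (forall x y, S x = S y).

Let s := S x0.
Let t := S (s x0) * s^-1.
Let e k := S (zpow s k x0).

Let ts : commute t s.
Proof.
by apply: commute_sym; apply: commuteM; [|apply: commuteV]; exact: commS.
Qed.

(** Both [z] and [t z] are images of [s^-1 z] under maps of the family [S]. *)
Let class_t z : c (t z) = c z.
Proof. by rewrite -[in RHS](perm_fun_invK s z); exact: class_S. Qed.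

Let class_zpowt k z : c (zpow t k z) = c z.
Proof.
elim/int_succ_ind: k z => [//|k].
split=> tk z; first by rewrite (zpowS t k) /= tk class_t.
have tK : t (t^-1 z) = z := perm_fun_invK t z.
have := tk (t^-1 z); rewrite (zpowS t k) PermME tK => ->.
by rewrite -(class_t (t^-1 z)) tK.
Qed.

Let class_powers i j : c (zpow s i (zpow t j x0)) = c (zpow s i x0).
Proof.
have /(congr1 (fun g : Perm X => g x0)) /= -> :
  commute (zpow s i) (zpow t j).
  by apply/commute_zpow/commute_sym/commute_zpow.
exact: class_zpowt.
Qed.

Let eE k : e k = s * zpow t k.
Proof.
have eS l : e (l + 1)%R = e l * t.
  (* This instance reads [e 1 * e l = e (l + 1) * s], and [t] is [e 1 * s^-1]. *)
  have := cycleS (zpow s 1%R x0) (zpow s l x0).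
  have -> : S (S (zpow s 1%R x0) (zpow s l x0)) = e (l + 1)%R.
    apply: class_perm; rewrite /e addrC (zpowD s 1%R l) zpow1.
    exact: class_S.
  have -> : S ((e (l + 1)%R)^-1 (zpow s 1%R x0)) = s.
    apply: class_perm; rewrite -[in RHS](perm_funK s x0).
    exact: class_SV.
  move=> /esym /(canRL (mulgK s)) ->.
by rewrite commS -mulgA.
elim/int_succ_ind: k => [|k]; first by rewrite mulg1.
by rewrite eS (zpowS t k) (mulgA s); split=> [->|/mulIg].
Qed.

Let permE x : exists k, S x = s * zpow t k.
Proof.
suff [k xk] : exists k, c x = c (zpow s k x0).
  by exists k; rewrite -eE; exact: class_perm.
(* On classes every [S y] acts as [s], so this set is stable. *)
apply: (@transS [set x | exists k, c x = c (zpow s k x0)] _ x0); last first.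
  by exists 0%R.
move=> y z [k zk]; split; [exists (1 + k)%R | exists (- (1 : int) + k)%R].
  by rewrite (zpowD s 1%R k); exact: class_S.
rewrite (zpowD s (- (1 : int))%R k) (zpowN s 1%R); exact: class_SV.
Qed.

Let h (a : int * int) : Perm X := zpow s a.1 * zpow t a.2.

Let hD : {morph h : a b / (a + b)%R >-> a * b}.
Proof.
move=> [i j] [k l]; rewrite /h /= (zpowD s i k) (zpowD t j l) !mulgA.
congr (_ * _); rewrite -!mulgA; congr (_ * _).
by apply/commute_zpow/commute_sym/commute_zpow/commute_sym.
Qed.

Let h0 : h 0%R = 1. Proof. by rewrite /h mulg1. Qed.

Let hN a : h (- a)%R = (h a)^-1.
Proof. by apply: (mulIg (h a)); rewrite -hD addNr h0 mulVg. Qed.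

Let hZ a (k : int) : h (a.1 * k, a.2 * k)%R = zpow (h a) k.
Proof.
elim/int_succ_ind: k => [|k]; first by rewrite !mulr0 h0.
rewrite (zpowS (h a) k) !mulrDr !mulr1.
have -> : h (a.1 * k + a.1, a.2 * k + a.2)%R = h (a.1 * k, a.2 * k)%R * h a.
  by rewrite -hD; congr h.
by split=> [->|/mulIg].
Qed.

Let h_onto x : exists a, x = h a x0.
Proof.
apply: (@transS [set x | exists a, x = h a x0] _ x0); last first.
  by exists 0%R; rewrite h0.
move=> y z [a ->]; have [k yE] := permE y.
have -> : S y = h (1%R, k) by [].
split; first by exists ((1, k) + a)%R; rewrite hD.
by exists (- (1, k) + a)%R; rewrite hD hN.
Qed.

Let perm_h i j : S (h (i, j) x0) = h (1%R, i).
Proof. by rewrite [RHS]/h /= -eE; apply: class_perm; exact: class_powers. Qed.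

(** In a transitive abelian group, an element fixing [x0] fixes each [h b x0], hence every point. *)
Let h_regular a : h a x0 = x0 -> h a = 1.
Proof.
move=> ax0; apply: PermP => x; have [b ->] := h_onto x.
by rewrite -[LHS]/((h a * h b) x0) -hD addrC hD PermME ax0.
Qed.

Let h_sub a b : h a x0 = h b x0 -> h (a - b)%R x0 = x0.
Proof. by move=> ab; rewrite addrC hD hN PermME ab; exact: perm_funK. Qed.

Let h_free i j : h (i, j) x0 = x0 -> i = 0%R /\ zpow t j = 1.
Proof.
move=> ijx0; have h1 := h_regular ijx0.
have ti : zpow t i = 1.
  (* The permutation attached to [x0] is [s], and the one attached to [h (i, j) x0] is
     [s * zpow t i]. *)
  apply: (mulgI s); rewrite mulg1 -[s in RHS]/(S x0) -[in RHS]ijx0.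
  by rewrite perm_h.
case: (eqVneq i 0%R) => [i0|i0].
  by split=> //; move: h1; rewrite /h /= i0 mul1g.
have tij : zpow t (i * j)%R = 1 by rewrite (zpowM t i j) ti zpow1g.
have tii : zpow t (i * i)%R = 1 by rewrite (zpowM t i i) ti zpow1g.
(* Raise the relation [h (i, j) = 1] to the power [i]; its [t] part vanishes by [tij]. *)
have sii : zpow s (i * i)%R = 1.
  have := hZ (i, j) i; rewrite h1 zpow1g /h /= mulrC [(j * i)%R]mulrC.
  by rewrite tij mulg1.
(* Both exponents of [h] can be reduced modulo [n], so the orbit of [x0], which is all of [X], would
   be finite. *)
pose n := (i * i)%R; case: infX.
pose I := [set Posz k | k in `I_`|n|].
have modI k : I (k %% n)%Z.
  have n0 : n != 0%R by rewrite mulf_neq0.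
  have := ltz_mod k n0; have := modz_ge0 k n0.
  by case: (k %% n)%Z => // l _ ln; exists l.
have -> : [set: X] = (fun p : int * int => h p x0) @` (I `*` I).
  apply/seteqP; split=> // x _; have [a ->] := h_onto x.
  exists (a.1 %% n, a.2 %% n)%Z; first by split; exact: modI.
  by congr (_ _); rewrite /h (zpow_mod a.1 sii) (zpow_mod a.2 tii).
by apply: finite_image; apply: finite_setX; apply: finite_image.
Qed.

Lemma commuting_cycle_set_classification : exists2 m : nat, m <> 1%N &
  exists2 f : X -> int * Zmod m, bijective f &
    forall x y, f (S x y) = sZ (f x) (f y).
Proof.
have [m tm] := zpow_order t; exists m.
  (* If [m = 1] then [t = 1], and every [S x] equals [s]. *)
  move=> m1; apply: nonconst => x y.
  have t1 : t = 1 by rewrite -[t]zpow1; apply/tm; rewrite m1 dvd1z.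
  by have [k ->] := permE x; have [l ->] := permE y; rewrite t1 !zpow1g.
have [lift liftK] := choice (@to_Zmod_surj m).
have t_eq j k : zpow t (j - k)%R = 1 <-> to_Zmod m j = to_Zmod m k.
  rewrite tm -to_Zmod_eq0 to_ZmodD to_ZmodN.
  by split=> [/eqP|->]; rewrite ?subrr // subr_eq0 => /eqP.
have h_eq i j k : to_Zmod m j = to_Zmod m k -> h (i, j) x0 = h (i, k) x0.
  move=> /t_eq jk; rewrite -[j](subrK k) /h /= (zpowD t (j - k)%R k).
  by rewrite jk mul1g.
(* The inverse of the isomorphism: undo the shear, then apply [h]. By [h_eq] the chosen lift does
   not matter. *)
pose g (a : int * Zmod m) := h (a.1, lift a.2 - tri a.1)%R x0.
have gS a b : g (sZ_fun a b) = S (g a) (g b).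
  rewrite /g perm_h -PermME -hD.
  have -> : ((1, a.1) + (b.1, lift b.2 - tri b.1) =
    (b.1 + 1, a.1 + (lift b.2 - tri b.1)))%R.
    by congr (_, _); rewrite /= addrC.
  apply: h_eq; rewrite to_ZmodD liftK /= -[in LHS](liftK b.2) -!to_ZmodD.
  (* From [tri (b.1 + 1) = tri b.1 + b.1] comes the summand [to_Zmod m b.1] of [sZ_fun]. *)
  by congr to_Zmod; rewrite triD (_ : tri 1 = 0%R) //; ring.
have g_inj : injective g.
  move=> [i u] [j v] /h_sub /(@h_free (i - j)%R _) [] /eqP.
  rewrite subr_eq0 => /eqP <- /t_eq; rewrite !to_ZmodD !liftK /=.
  by move=> /addIr ->.
have g_surj x : exists a, g a = x.
  have [[i j] ->] := h_onto x; exists (i, to_Zmod m (j + tri i))%R.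
  by apply: h_eq; rewrite /= to_ZmodD liftK -to_ZmodD addrK.
have [f fK] := choice g_surj.
have gK : cancel g f by move=> a; apply: g_inj; rewrite fK.
exists f; first by exists g.
by move=> x y; apply: g_inj; rewrite fK gS !fK.
Qed.
End Classification.

Lemma perm_of_bij (X : Type) (f : X -> X) :
  bijective f -> exists g : Perm X, perm_fun g = f.
Proof. by case=> f' fK f'K; exists (MkPerm fK f'K). Qed.

(** * Involutive solutions in terms of their sigma maps *)

Section Involutive.
Local Open Scope classical_set_scope.
Local Open Scope group_scope.
Variables (X : Type) (r : X * X -> X * X) (S : X -> Perm X).
Hypothesis solr : is_solution r.
Hypothesis invr : is_involutive r.
Hypothesis SE : forall x, perm_fun (S x) = sigma r x.

(** The first component of [r (r (x, y)) = (x, y)] says that [S (S x y)] sends [tau r y x] to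
    [x]. *)
Lemma involutive_tau x y : tau r y x = (S (S x y))^-1 x.
Proof.
apply: (canRL (perm_funK _)); rewrite !SE /sigma /tau -surjective_pairing.
by have := congr1 (fun f => (f (x, y)).1) invr; rewrite /= => ->.
Qed.

Lemma involutive_cycle x y : S x * S y = S (S x y) * S ((S (S x y))^-1 x).
Proof.
by apply: PermP => z; rewrite -involutive_tau !PermME !SE sol_sigmaM.
Qed.

Lemma abelian_sigma : abelian_set (permutation_group r) ->
  forall x y, commute (S x) (S y).
Proof.
move=> ab; have gen x : exists T, permutation_group r (S x, T).
  have [T TE] := perm_of_bij (sol_tau_bij solr x).
  exists T^-1; apply: generated_sub; exists x.
  by split; [exact: SE | exact: TE].
move=> x y; have [[T gx] [U gy]] := (gen x, gen y).
by have /(congr1 fst) := ab _ _ gx gy.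
Qed.

(** The permutations preserving membership in [O] both ways form a subgroup; it contains every
    sigma, and every tau as an inverse sigma. *)
Lemma indecomposable_sub (O : set X) : indecomposable r ->
  (forall x z, O z -> O (S x z) /\ O ((S x)^-1 z)) ->
  (forall y, exists w, tau r y = (S w)^-1) -> forall x y, O x -> O y.
Proof.
move=> ind OS tauS x y; have [g gg <-] := ind x y.
suff gO : [set k : Perm X | forall z, O z <-> O (k z)] g by move/gO.
apply: gg.
split; first split=> [//|k h kO hO z|k kO z]; first by rewrite hO kO.
  by rewrite (kO (k^-1 z)); have -> : k (k^-1 z) = z := perm_fun_invK k z.
have SO w z : O z <-> O (S w z).
  split=> [/(OS w)[]//|/(OS w)[_]].
  by have -> : (S w)^-1 (S w z) = z := perm_funK (S w) z.
move=> {}g [w [] gE] z; first by rewrite gE -SE.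
have [v vE] := tauS w.
have -> : g z = (S v)^-1 z by rewrite gE vE.
rewrite (SO v ((S v)^-1 z)).
by have -> : S v ((S v)^-1 z) = z := perm_fun_invK (S v) z.
Qed.

Lemma isomorphic_of_sigma (Y : Type) (s : Y -> Perm Y) (f : X -> Y) :
  bijective f -> (forall x y, f (S x y) = s (f x) (f y)) ->
  isomorphic_sol r (of_sigma s).
Proof.
move=> bf fS; exists f => // x y.
have -> : r (x, y) = (S x y, (S (S x y))^-1 x).
  by rewrite -involutive_tau SE /sigma /tau -surjective_pairing.
rewrite /of_sigma /= fS; congr (_, _).
apply: (canRL (perm_funK _)); rewrite -fS -fS; congr f.
exact: perm_fun_invK.
Qed.

End Involutive.

(** * Solutions of multipermutation level two *)

Section LevelTwo.
Local Open Scope classical_set_scope.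
Variables (X : Type) (r : X * X -> X * X).
Hypotheses (solr : is_solution r) (invr : is_involutive r).
Hypotheses (indr : indecomposable r) (infX : infinite_set [set: X]).
Hypotheses (abr : abelian_set (permutation_group r)).
Hypotheses (lev2 : multipermutation_level r 2).

Lemma level_two_classification :
  exists2 m : nat, m <> 1 & isomorphic_sol r (solZ m).
Proof.
have [x0] := sol_nonempty solr.
have [S SE] := choice (fun x => perm_of_bij (sol_sigma_bij solr x)).
have tauE := involutive_tau invr SE.
case: (lev2) => /(size_one_ret_ret x0 solr) level lev1.
have class_perm x y : ret_pi r x = ret_pi r y -> S x = S y.
  by move=> /ret_piP[sxy _]; apply: PermP => z; rewrite !SE sxy.
have class_S x y u v : ret_pi r u = ret_pi r v ->
    ret_pi r (S x u) = ret_pi r (S y v).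
  move=> uv; rewrite !SE (level x y u).1.
  exact: (ret_congr solr erefl uv).1.
(* Writing an inverse sigma, at a given point, as a tau lets the tau half of [level] control
   inverses. *)
have tauSV w u : ((S w)^-1)%g u = tau r (((S u)^-1)%g w) u.
  by rewrite tauE; have -> : S u ((S u)^-1%g w) = w := perm_fun_invK (S u) w.
have class_SV x y u v : ret_pi r u = ret_pi r v ->
    ret_pi r ((S x)^-1%g u) = ret_pi r ((S y)^-1%g v).
  move=> uv; rewrite (tauSV x u) (tauSV y v) (level _ (((S v)^-1)%g y) u).2.
  exact: (ret_congr solr uv erefl).2.
have tauS y : exists w, tau r y = (S w)^-1%g.
  (* The class of [S x y] does not depend on [x], so [x] may be replaced by [y] there. *)
  exists (S y y); apply/funext => x; rewrite tauE.
  rewrite (class_perm (S x y) (S y y)) //; exact: class_S.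
have nonconst : ~ (forall x y, S x = S y).
  (* If all sigmas agree, so do all taus by [tauS], and the first retraction is already a point. *)
  move=> Sconst; apply: (lev1 1) => //=; apply/(size_one_ret r x0) => x y.
  split; first by rewrite -!SE (Sconst x y).
  by have [[v ->] [w ->]] := (tauS x, tauS y); rewrite (Sconst v w).
have [m m1 [f bf fS]] :=
  commuting_cycle_set_classification x0 class_perm class_S class_SV
  (abelian_sigma solr SE abr) (involutive_cycle solr invr SE)
  (fun O OS => indecomposable_sub SE indr OS tauS) infX nonconst.
by exists m => //; exact: (isomorphic_of_sigma invr SE bf fS).
Qed.
End LevelTwo.

Theorem theorem8p2 :
  (forall m : nat, m <> 1 ->
     [/\ is_solution (solZ m), is_involutive (solZ m), indecomposable (solZ m)
       & infinite_set [set: int * Zmod m]]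
     /\ isog_additive (int * Zmod m)%type (permutation_group (solZ m))
     /\ multipermutation_level (solZ m) 2)
  /\
  (forall (X : Type) (r : X * X -> X * X),
     is_solution r -> is_involutive r -> indecomposable r ->
     infinite_set [set: X] ->
     abelian_set (permutation_group r) ->
     multipermutation_level r 2 ->
     exists2 m : nat, m <> 1 & isomorphic_sol r (solZ m)).
Proof.
split=> [m m1|X r]; last exact: level_two_classification.
split; first split.
- exact: solZ_solution.
- exact: solZ_involutive.
- exact: solZ_indecomposable.
- exact: infinite_intZ.
by split; [exact: solZ_permutation_group | exact: solZ_level].
Qed.
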